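(* Let $n\ge 2$ and let $k>0$ be a constant. Suppose that $\Omega$ is a bounded convex domain in $\mathbb{R}^n$ with $\mathbf 0\in\Omega$, that $x_0\in\partial\Omega$, and that $\Omega$ satisfies the $(a_1,\dots,a_{n-1})$-interior convex condition at $x_0$ (with constants $\eta_1,\dots,\eta_{n-1},h>0$). Let $$\theta=\frac{\bar a+2+k}{2n+2k+2},\qquad \bar a=\sum_{i=1}^{n-1}\frac{2}{a_i}.$$ If $u\in C(\overline\Omega)$ is a convex viscosity sub-solution to the problem $$\det D^2u=|u|^{-n-k-2}(x\cdot Du-u)^{-k}\ \text{ in }\Omega,\qquad u=0\ \text{ on }\partial\Omega,$$ then $$|u(x)|\ge C\,d_x^{\,\theta}\quad\text{for all }x\in\Omega\text{ such that }d_x=|x-x_0|<\tfrac38 h$$ for some positive constant $C$ depending only on $n$, $k$, $\operatorname{diam}\Omega$ and the numbers $a_1,\dots,a_{n-1},\eta_1,\dots,\eta_{n-1},h$ in the interior convex condition at $x_0$.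
   Context: Notation: $d_x=\operatorname{dist}(x,\partial\Omega)$; $\mathbb{R}^n_+=\{x\in\mathbb{R}^n:x_n>0\}$. Interior convex condition: Let $\Omega\subset\mathbb{R}^n$ be a bounded convex domain, $x_0\in\partial\Omega$, and $a_i\ge 1$ for $i=1,\dots,n-1$. $\Omega$ satisfies the $(a_1,\dots,a_{n-1})$-interior convex condition at $x_0$ if there exist positive constants $\eta_1,\dots,\eta_{n-1},h$ such that, after a suitable translation and rotation, $x_0=\mathbf 0$ and $$\{x\in\mathbb{R}^n:\eta_1|x_1|^{a_1}+\cdots+\eta_{n-1}|x_{n-1}|^{a_{n-1}}<x_n<h\}\subseteq\Omega\subseteq\mathbb{R}^n_+.$$ Convex viscosity sub-solution: Let $\Omega$ be a convex domain with $\mathbf 0\in\Omega$, and let $u\in C(\overline\Omega)$ be convex in $\Omega$ with $u<0$ in $\Omega$. $u$ is a convex viscosity sub-solution of the equation $\det D^2u=|u|^{-n-k-2}(x\cdot Du-u)^{-k}$ in $\Omega$ if, whenever $\phi\in C^2(\Omega)$ is convex and $z\in\Omega$ are such that $(u-\phi)(x)\le(u-\phi)(z)$ for all $x$ in a neighborhood of $z$, one has $$\det D^2\phi(z)\ge|u(z)|^{-n-k-2}\,(z\cdot D\phi(z)-u(z))^{-k}.$$ It is a convex viscosity sub-solution to the boundary value problem if in addition $u=0$ on $\partial\Omega$. *)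

(* Defs.v *)
From HB Require Import structures.
From mathcomp Require Export all_boot all_order all_algebra.
From mathcomp Require Export all_classical all_reals all_analysis.
Export Order.TTheory GRing.Theory Num.Theory.
Export numFieldNormedType.Exports.

Set Implicit Arguments.
Unset Strict Implicit.
Unset Printing Implicit Defensive.

Local Open Scope classical_set_scope.
Local Open Scope ring_scope.

Section Geometry.
Context {R : realType} {n : nat}.
Implicit Types (A : set 'rV[R]_n) (x y : 'rV[R]_n).

Definition dot x y : R := \sum_(i < n) x 0 i * y 0 i.

(* The library norm `|x| on 'rV[R]_n is the sup norm; it induces the same
   topology and the same bounded sets, but lengths have to be Euclidean. *)
Definition enorm x : R := Num.sqrt (dot x x).

Definition boundary A : set 'rV[R]_n := closure A `\` A°.

Definition dist_to x A : R := inf [set enorm (x - y) | y in A].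

Definition diam A : R := sup [set enorm (x - y) | x in A & y in A].

(* A nonempty convex set is connected, so connectedness is not repeated. *)
Definition convex_domain A : Prop :=
  [/\ open A, A !=set0 & @convex_set R 'rV[R]_n A].

Definition rotation (Q : 'M[R]_n) : Prop := Q *m Q^T = 1%:M /\ \det Q = 1.

End Geometry.

Section Calculus.
Context {R : realType} {n : nat}.
Implicit Types (Omega : set 'rV[R]_n) (f : 'rV[R]_n -> R) (x : 'rV[R]_n).

Definition partial (i : 'I_n) f : 'rV[R]_n -> R := 'D_(delta_mx 0 i) f.

Definition gradient f x : 'rV[R]_n := \row_i partial i f x.

Definition hessian f x : 'M[R]_n := \matrix_(i, j) partial i (partial j f) x.

(* For Omega open, all the conditions below depend only on f restricted to
   Omega. *)
Definition C0_on Omega f : Prop := forall x, Omega x -> {for x, continuous f}.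

Definition C1_on Omega f : Prop :=
  C0_on Omega f /\
  forall i : 'I_n, (forall x, Omega x -> derivable f x (delta_mx 0 i)) /\
                   C0_on Omega (partial i f).

Definition C2_on Omega f : Prop :=
  C1_on Omega f /\ forall i : 'I_n, C1_on Omega (partial i f).

End Calculus.

(* The ambient space is R^(n+1), so that x_1, ..., x_n are the coordinates
   indexed by widen_ord and the last coordinate is the one at ord_max.
   The motion x |-> (x - x0) Q is the general composite of a translation and a
   rotation sending x0 to 0. *)
Definition interior_convex_condition (R : realType) (n : nat)
    (Omega : set 'rV[R]_n.+1) (x0 : 'rV[R]_n.+1)
    (a eta : 'I_n -> R) (h : R) : Prop :=
  [/\ [/\ bounded_set Omega, convex_domain Omega & boundary Omega x0],
      forall i, 1 <= a i,
      forall i, 0 < eta i,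
      0 < h
    & exists2 Q : 'M[R]_n.+1, rotation Q &
        let Omega' := [set (x - x0) *m Q | x in Omega] in
        [set y : 'rV[R]_n.+1 |
            \sum_(i < n) eta i * `|y 0 (widen_ord (leqnSn n) i)| `^ a i
              < y 0 ord_max < h] `<=` Omega'
        /\ Omega' `<=` [set y : 'rV[R]_n.+1 | 0 < y 0 ord_max]].

Section Viscosity.
Context {R : realType} {n : nat}.
Implicit Types (Omega : set 'rV[R]_n) (u : 'rV[R]_n -> R).

(* Elements of C(closure Omega) are represented by total functions, whose
   values outside closure Omega play no role. *)
Definition convex_viscosity_subsolution (k : R) Omega u : Prop :=
  [/\ convex_domain Omega /\ Omega 0,
      {within closure Omega, continuous u},
      @convex_function R 'rV[R]_n Omega u,
      forall x, Omega x -> u x < 0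
    & forall (phi : 'rV[R]_n -> R) (z : 'rV[R]_n),
        C2_on Omega phi -> @convex_function R 'rV[R]_n Omega phi ->
        Omega z -> (\forall x \near z, u x - phi x <= u z - phi z) ->
        `|u z| `^ (- n%:R - k - 2) * (dot z (gradient phi z) - u z) `^ (- k)
          <= \det (hessian phi z)].

Definition convex_viscosity_subsolution_bvp (k : R) Omega u : Prop :=
  convex_viscosity_subsolution k Omega u /\
  forall x, boundary Omega x -> u x = 0.

End Viscosity.

Definition abar (R : realType) (n : nat) (a : 'I_n -> R) : R :=
  \sum_(i < n) 2 / a i.

Definition theta (R : realType) (n : nat) (k : R) (b : R) : R :=
  (b + 2 + k) / (2 * n%:R + 2 * k + 2).

(* Main.v *)
Require Import Defs.
From mathcomp Require Import ring lra.
Local Open Scope classical_set_scope.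
Local Open Scope ring_scope.

(* Write n = m + 1, d = |x - x0| and M = -u(x).  In the coordinates of the
   interior convex condition x is the point d e_n, and Omega contains the
   ellipsoid E centred at x with semi-axes r_i ~ d^(1/a_i) (i < n) and
   r_n = d / 2.  Let q be the quadratic form with E = {q <= 1}, vanishing at x.
   Since u < 0, the function u - 2 M q is at most -2 M on the boundary of E and
   equals -M at x, so its maximum over E is attained at an interior point z, and
   phi = 2 M q is admissible there.  At z we have |u| <= M, and
   z . Dphi - u <= C M / d because |Dphi| <= C M / d; it is positive because phi
   touches the convex function u from above, hence Dphi(z) is a subgradient and
   z . Dphi(z) - u(z) >= -u(0).  The equation becomes
   M^(-n-k-2) (M / d)^(-k) <= C M^n / prod r_i^2 ~ M^n d^(-abar-2),
   that is, M^(2n+2k+2) >= c d^(abar+2+k). *)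

(** * Euclidean lengths, rotations, diameter and boundary crossing *)

Section Euclidean.
Context {R : realType} {n : nat}.
Implicit Types (x y v : 'rV[R]_n) (Q : 'M[R]_n) (A : set 'rV[R]_n).

Lemma dotE x y : dot x y = (x *m y^T) 0 0.
Proof. by rewrite /dot mxE; apply: eq_bigr => i _; rewrite mxE. Qed.

Lemma dotxx_ge0 x : 0 <= dot x x.
Proof. by apply: sumr_ge0 => i _; rewrite -expr2 sqr_ge0. Qed.

Lemma enorm_ge0 x : 0 <= enorm x.
Proof. exact: sqrtr_ge0. Qed.

Lemma sqr_enorm x : enorm x ^+ 2 = \sum_i x 0 i ^+ 2.
Proof. by rewrite sqr_sqrtr ?dotxx_ge0//; apply: eq_bigr => i _; rewrite expr2. Qed.

Lemma ler_coord_enorm x i : `|x 0 i| <= enorm x.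
Proof.
rewrite -(ler_pXn2r (n := 2))// ?nnegrE ?enorm_ge0// real_normK ?num_real//.
rewrite sqr_enorm (bigD1 i)//= lerDl.
by apply: sumr_ge0 => j _; exact: sqr_ge0.
Qed.

Lemma enormZ t x : enorm (t *: x) = `|t| * enorm x.
Proof.
rewrite /enorm -sqrtr_sqr -sqrtrM ?sqr_ge0//; congr (Num.sqrt _).
by rewrite /dot mulr_sumr; apply: eq_bigr => i _; rewrite !mxE; ring.
Qed.

Lemma enorm_rotation Q x : rotation Q -> enorm (x *m Q) = enorm x.
Proof.
case=> QQ _; rewrite /enorm !dotE trmx_mul mulmxA -(mulmxA x) QQ mulmx1//.
Qed.

Lemma rotation_mulVmx Q : rotation Q -> Q^T *m Q = 1%:M.
Proof. by case=> /mulmx1C. Qed.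

(** Transfers boundedness, which is expressed in the sup norm, to Euclidean lengths; the crude
    factor [n] in place of its square root is enough. *)
Lemma enorm_le_norm x : enorm x <= n%:R * `|x|.
Proof.
rewrite -(ler_pXn2r (n := 2))// ?nnegrE ?enorm_ge0 ?mulr_ge0//.
rewrite sqr_enorm exprMn.
have H i : x 0 i ^+ 2 <= `|x| ^+ 2.
  rewrite -(real_normK (num_real (x 0 i))) ler_pXn2r ?nnegrE//.
  rewrite [leRHS]/Num.norm/= mx_normrE.
  exact: (le_bigmax _ (fun ij => `|x ij.1 ij.2|) (0, i)).
apply: (le_trans (ler_sum _ (fun i _ => H i))).
rewrite sumr_const card_ord -[leLHS]mulr_natl; apply: ler_wpM2r; first exact: sqr_ge0.
by rewrite -natrX ler_nat; case: (n) => // p; rewrite leq_pmulr.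
Qed.

Lemma enorm_le_diam A x y : bounded_set A -> A x -> A y ->
  enorm (x - y) <= diam A.
Proof.
move=> [B [_ bA]] Ax Ay; apply: ub_le_sup; last by exists x => //; exists y.
(* [B + 1] appears because [bounded_set] bounds the norm only by numbers strictly above [B]. *)
exists (n%:R * (2 * (B + 1))) => _ [p Ap [q Aq <-]].
apply: (le_trans (enorm_le_norm _)); apply: ler_wpM2l => //.
apply: (le_trans (ler_normB _ _)).
have bB : B < B + 1 by rewrite ltrDl.
have := bA _ bB p Ap; have := bA _ bB q Aq; rewrite /=; lra.
Qed.

Lemma dist_to_le A x b : A b -> dist_to x A <= enorm (x - b).
Proof.
move=> Ab; apply: ge_inf; last by exists b.
by exists 0 => _ [c _ <-]; exact: enorm_ge0.
Qed.

(** The crossing parameter is the supremum of those [t] whose point lies in [A]: the point there is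
    a limit of points of [A], and were it interior, slightly larger parameters would still give
    points of [A]. *)
Lemma segment_meets_boundary A x w : open A -> A x -> ~ A w ->
  exists2 t : R, 0 <= t <= 1 & boundary A (x + t *: (w - x)).
Proof.
move=> oA Ax nAw.
pose p (t : R) := x + t *: (w - x).
pose S := [set t : R | 0 <= t <= 1 /\ A (p t)].
have p0 : p 0 = x by rewrite /p scale0r addr0.
have p1 : p 1 = w by rewrite /p scale1r addrC subrK.
have S0 : S 0 by split; [rewrite lexx ler01 | rewrite p0].
have hS : has_sup S.
  by split; [exists 0 | exists 1 => t [/andP[]]].
have cp : continuous p.
  move=> t; apply: cvgD; first exact: cvg_cst.
  by apply: cvgZr_tmp; exact: cvg_id.
have sge : 0 <= sup S by apply: ub_le_sup => //; case: hS.
have sle : sup S <= 1 by apply: ge_sup; [case: hS | move=> t [/andP[]]].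
exists (sup S); first by rewrite sge sle.
split.
  move=> B nB.
  have /nbhs_ballP[e /= e0 eB] : nbhs (sup S) (p @^-1` B) by exact: cp.
  have [t St tgt] := sup_adherent e0 hS.
  exists (p t); split; first by case: St.
  apply: eB; rewrite /ball/= ger0_norm ?subr_ge0.
    by rewrite ltrBlDl -ltrBlDr.
  by apply: ub_le_sup => //; case: hS.
move=> /interior_subset Ap.
  have /nbhs_ballP[e /= e0 eB] : nbhs (sup S) (p @^-1` A).
    by apply: cp; exact: open_nbhs_nbhs.
  have s1 : sup S < 1.
    rewrite lt_neqAle sle andbT; apply/eqP => s1.
    by apply: nAw; rewrite -p1 -s1.
  pose t := Num.min 1 (sup S + e / 2).
  have t_gt : sup S < t by rewrite lt_min s1 ltrDl divr_gt0.
  have St : S t.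
    split; first by rewrite (le_trans sge (ltW t_gt)) /t ge_min lexx.
    apply: eB; rewrite /ball/= distrC ger0_norm ?subr_ge0 1?ltW//.
    rewrite ltrBlDl (le_lt_trans (y := sup S + e / 2))//.
      by rewrite /t ge_min lexx orbT.
    by rewrite ltrD2l; lra.
  suff : t <= sup S by rewrite leNgt t_gt.
  by apply: ub_le_sup => //; case: hS.
Qed.

End Euclidean.

(** * Tools on derivatives, continuity and convexity *)

Lemma is_derive_quadratic {R : numFieldType} {V : normedModType R}
    (f : V -> R) (a v : V) (B G : R) :
    (forall t, f (t *: v + a) = f a + t * B + t ^+ 2 * G) ->
  is_derive a v f B.
Proof.
move=> fE.
(* The difference quotient is exactly [B + h * G], so its limit is immediate. *)
have cvB : h^-1 *: ((f \o shift a) (h *: v) - f a) @[h --> 0^'] --> B.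
  have : (B + h * G) @[h --> 0^'] --> B + 0 * G.
    apply: cvg_within_filter.
    by apply: cvgD; [exact: cvg_cst | apply: cvgMr_tmp; exact: cvg_id].
  rewrite mul0r addr0; apply: cvg_trans; apply: near_eq_cvg.
  near=> h; rewrite /= fE /GRing.scale/=.
  have h0 : h != 0 by near: h; exact: nbhs_dnbhs_neq.
  by field.
by split; [apply: cvgP cvB | apply: cvg_lim cvB].
Unshelve. all: by end_near. Qed.

Lemma continuous_sumr {R : numFieldType} {T : topologicalType} (I : finType)
    (f : I -> T -> R) :
  (forall i, continuous (f i)) -> continuous (fun y => \sum_i f i y).
Proof.
move=> fc y; apply: cvg_big => [|i _]; first exact: add_continuous.
exact: fc.
Qed.

Lemma convex_functionP {R : realType} {V : lmodType R} (A : set V) (f : V -> R) :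
  @convex_function R V A f <->
  forall x y t, 0 <= t -> t <= 1 -> A x -> A y ->
    f (t *: x + (1 - t) *: y) <= t * f x + (1 - t) * f y.
Proof.
split=> [fA x y t t0 t1 Ax Ay|fA t x y /set_mem Ax /set_mem Ay].
  have := fA (Itv01 t0 t1) x y (mem_set Ax) (mem_set Ay).
  exact.
exact: fA.
Qed.

(** * Quadratic test functions diagonal in a rotated frame *)

Section QuadraticForm.
Context {R : realType} {n : nat}.
Variables (c : 'I_n -> R) (Q : 'M[R]_n).
Implicit Types (x y z v w : 'rV[R]_n) (Omega : set 'rV[R]_n).

(** For orthogonal [Q] this is the symmetric form with eigenvalues [c j]; keeping [c] and [Q] apart
    turns the Hessian determinant into a product. *)
Definition bilin v w : R := \sum_j c j * ((v *m Q) 0 j * (w *m Q) 0 j).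

Definition quad x y : R := bilin (y - x) (y - x).

Lemma bilinE v w :
  bilin v w = (v *m (Q *m diag_mx (\row_j c j) *m Q^T) *m w^T) 0 0.
Proof.
rewrite !mulmxA -(mulmxA _ Q^T) -trmx_mul mxE; apply: eq_bigr => j _.
rewrite mul_mx_diag !mxE; ring.
Qed.

Lemma bilinC v w : bilin v w = bilin w v.
Proof. by apply: eq_bigr => j _; rewrite [_ * (w *m Q) 0 j]mulrC. Qed.

Lemma bilinDl v1 v2 w : bilin (v1 + v2) w = bilin v1 w + bilin v2 w.
Proof. by rewrite !bilinE !mulmxDl mxE. Qed.

Lemma bilinZl t v w : bilin (t *: v) w = t * bilin v w.
Proof. by rewrite !bilinE -!scalemxAl mxE. Qed.

Lemma bilinDr v w1 w2 : bilin v (w1 + w2) = bilin v w1 + bilin v w2.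
Proof. by rewrite bilinC bilinDl !(bilinC v). Qed.

Lemma bilinZr t v w : bilin v (t *: w) = t * bilin v w.
Proof. by rewrite bilinC bilinZl bilinC. Qed.

Lemma bilin_ge0 v : (forall j, 0 <= c j) -> 0 <= bilin v v.
Proof.
by move=> c0; apply: sumr_ge0 => j _; rewrite mulr_ge0// -expr2 sqr_ge0.
Qed.

Lemma bilin_sumr v (I : finType) (F : I -> 'rV[R]_n) :
  bilin v (\sum_i F i) = \sum_i bilin v (F i).
Proof.
elim/big_ind2 : _ => [|? ? ? ? <- <-|//]; last by rewrite bilinDr.
by rewrite -(scale0r (0 : 'rV[R]_n)) bilinZr mul0r.
Qed.

Lemma quad_shift x y t v :
  quad x (t *: v + y) = quad x y + t * (2 * bilin (y - x) v) + t ^+ 2 * bilin v v.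
Proof.
rewrite /quad -addrA; move: (y - x) => w.
rewrite !bilinDl !bilinDr !bilinZl !bilinZr (bilinC v w); ring.
Qed.

Lemma is_derive_quad x y v : is_derive y v (quad x) (2 * bilin (y - x) v).
Proof. apply: (@is_derive_quadratic _ _ _ _ _ _ (bilin v v)) => t; exact: quad_shift. Qed.

Lemma is_derive_bilin x y v w :
  is_derive y v (fun y' => 2 * bilin (y' - x) w) (2 * bilin v w).
Proof.
apply: (@is_derive_quadratic _ _ _ _ _ _ 0) => t.
rewrite -[t *: v + y - x]addrA (bilinDl (t *: v)) bilinZl; ring.
Qed.

Lemma partial_quad x i : partial i (quad x) = fun y => 2 * bilin (y - x) (delta_mx 0 i).
Proof.
apply/funext => y.
exact: (@derive_val _ _ _ _ _ _ _ (is_derive_quad _ _ _)).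
Qed.

Lemma partial_bilin x i w :
  partial i (fun y => 2 * bilin (y - x) w) = fun=> 2 * bilin (delta_mx 0 i) w.
Proof.
apply/funext => y.
exact: (@derive_val _ _ _ _ _ _ _ (is_derive_bilin _ _ _ _)).
Qed.

Lemma continuous_coord_mulmx x j : continuous (fun y => ((y - x) *m Q) 0 j).
Proof.
have -> : (fun y => ((y - x) *m Q) 0 j) =
    fun y => \sum_i (y 0 i - x 0 i) * Q i j.
  by apply/funext => y; rewrite mxE; apply: eq_bigr => i _; rewrite !mxE.
apply: continuous_sumr => i y.
apply: (@cvgMr_tmp _ _ _ (nbhs_filter y)).
apply: (@cvgB _ _ _ _ (nbhs_filter y)); first exact: coord_continuous.
exact: cvg_cst.
Qed.

Lemma continuous_quad x : continuous (quad x).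
Proof.
apply: continuous_sumr => j y; apply: (@cvgMl_tmp _ _ _ (nbhs_filter y)).
by apply: (@cvgM _ _ _ (nbhs_filter y)); exact: continuous_coord_mulmx.
Qed.

Lemma continuous_bilin x w : continuous (fun y => 2 * bilin (y - x) w).
Proof.
move=> y; apply: (@cvgMl_tmp _ _ _ (nbhs_filter y)); move: y.
apply: continuous_sumr => j y; apply: (@cvgMl_tmp _ _ _ (nbhs_filter y)).
by apply: (@cvgMr_tmp _ _ _ (nbhs_filter y)); exact: continuous_coord_mulmx.
Qed.

Lemma C2_on_quad Omega x : C2_on Omega (quad x).
Proof.
split=> [|i].
  split=> [y _|i]; first exact: continuous_quad.
  split=> y _; first exact: (@ex_derive _ _ _ _ _ _ _ (is_derive_quad x y _)).
  by rewrite partial_quad; exact: continuous_bilin.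
rewrite partial_quad; split=> [y _|j]; first exact: continuous_bilin.
split=> y _; first exact: (@ex_derive _ _ _ _ _ _ _ (is_derive_bilin x y _ _)).
by rewrite partial_bilin; exact: cst_continuous.
Qed.

Lemma dot_gradient_quad x z v : dot v (gradient (quad x) z) = 2 * bilin (z - x) v.
Proof.
rewrite [v in RHS]row_sum_delta bilin_sumr mulr_sumr; apply: eq_bigr => i _.
by rewrite mxE partial_quad bilinZr; ring.
Qed.

Lemma hessian_quad x z :
  hessian (quad x) z = 2 *: (Q *m diag_mx (\row_j c j) *m Q^T).
Proof.
apply/matrixP => i j; rewrite [LHS]mxE partial_quad partial_bilin.
rewrite bilinE -rowE trmx_delta -colE !mxE//.
Qed.

Lemma det_hessian_quad x z : rotation Q ->
  \det (hessian (quad x) z) = 2 ^+ n * \prod_j c j.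
Proof.
case=> _ dQ; rewrite hessian_quad detZ !det_mulmx det_tr dQ mul1r mulr1 det_diag.
by congr (_ * _); apply: eq_bigr => j _; rewrite mxE.
Qed.

Lemma convex_quad Omega x : (forall j, 0 <= c j) ->
  @convex_function R 'rV[R]_n Omega (quad x).
Proof.
move=> c0; apply/convex_functionP => y w t t0 t1 _ _.
(* The convexity defect of a quadratic function is explicit, and nonnegative because the form is. *)
have -> : quad x (t *: y + (1 - t) *: w) =
  t * quad x y + (1 - t) * quad x w - t * (1 - t) * bilin (y - w) (y - w).
  rewrite /quad.
  have -> : t *: y + (1 - t) *: w - x = t *: (y - x) + (1 - t) *: (w - x).
    by apply/rowP => i; rewrite !mxE; ring.
  have -> : y - w = (y - x) + (-1) *: (w - x).
    by apply/rowP => i; rewrite !mxE; ring.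
  move: (y - x) (w - x) => {}y {}w.
  rewrite !bilinDl !bilinDr !bilinZl !bilinZr (bilinC w y); ring.
by rewrite gerBl !mulr_ge0 ?subr_ge0 ?bilin_ge0.
Qed.

End QuadraticForm.

(** * The viscosity inequality on an ellipsoid inside the domain *)

Lemma quad_coord_le {R : realType} {n : nat} (r : 'I_n -> R) (Q : 'M[R]_n)
    (x y : 'rV[R]_n) (j : 'I_n) :
    (forall i, 0 < r i) -> quad (fun i => r i ^- 2) Q x y <= 1 ->
  `|((y - x) *m Q) 0 j| <= r j.
Proof.
move=> r0 qy1.
rewrite -(ler_pXn2r (n := 2))// ?nnegrE ?(ltW (r0 j))// real_normK ?num_real//.
suff : r j ^- 2 * ((y - x) *m Q) 0 j ^+ 2 <= 1.
  by rewrite mulrC ler_pdivrMr ?exprn_gt0// mul1r.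
apply: le_trans qy1; rewrite /quad /bilin (bigD1 j)//= -expr2 lerDl.
apply: sumr_ge0 => i _; apply: mulr_ge0; last by rewrite -expr2 sqr_ge0.
by rewrite invr_ge0 sqr_ge0.
Qed.

(** Here [B] stands for z . Dphi(z). As [z] is a convex combination of [(1 + s) z] and [0],
    convexity gives (1 + s) u(z) <= u((1 + s) z) + s u(0); touching bounds u((1 + s) z) by u(z) + s
    B + s^2 G. Dividing by [s] leaves B - u(z) >= -u(0) - s G, positive for small [s]. *)
Lemma touching_support_gt0 {R : realType} {n : nat} (A : set 'rV[R]_n)
    (u phi : 'rV[R]_n -> R) (z : 'rV[R]_n) (B G : R) :
    convex_domain A -> A 0 -> @convex_function R 'rV[R]_n A u -> u 0 < 0 ->
    A z -> (\forall y \near z, u y - phi y <= u z - phi z) -> 0 <= G ->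
    (forall s, phi (s *: z + z) = phi z + s * B + s ^+ 2 * G) ->
  0 < B - u z.
Proof.
move=> [oA _ _] A0 /convex_functionP cu u0 Az tz G0 phiE.
have cz : (s *: z + z) @[s --> 0^'+] --> z.
  have : (s *: z + z) @[s --> 0^'+] --> 0 *: z + z.
    apply: cvg_within_filter; apply: cvgD; last exact: cvg_cst.
    by apply: cvgZr_tmp; exact: cvg_id.
  by rewrite scale0r add0r.
have As : \forall s \near 0^'+, A (s *: z + z).
  by apply: cz; exact: open_nbhs_nbhs.
have us : \forall s \near 0^'+,
    u (s *: z + z) - phi (s *: z + z) <= u z - phi z.
  exact: (cz _ tz).
near (0 : R)^'+ => s.
have s0 : 0 < s by near: s; exact: nbhs_right_gt.
have sG : s * G < - u 0.
  (* [G + 1] replaces [G] since [G] may vanish. *)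
  have : s < - u 0 / (G + 1).
    by near: s; apply: nbhs_right_lt; rewrite divr_gt0 ?oppr_gt0// ltr_wpDl.
  rewrite ltr_pdivlMr ?ltr_wpDl//; nra.
have As' : A (s *: z + z) by near: s.
have : u (s *: z + z) - phi (s *: z + z) <= u z - phi z by near: s.
rewrite phiE => le1.
pose t := (1 + s)^-1.
have ts : t * (1 + s) = 1 by rewrite mulVf// lt0r_neq0// addr_gt0.
have t0 : 0 <= t by rewrite invr_ge0 addr_ge0// ltW.
have t1 : t <= 1 by rewrite invf_le1 ?addr_gt0// lerDl ltW.
have := cu _ _ _ t0 t1 As' A0.
rewrite scaler0 addr0.
have -> : t *: (s *: z + z) = z.
  by rewrite -[X in _ + X]scale1r -scalerDl scalerA [s + 1]addrC ts scale1r.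
have s1 : 0 < 1 + s by rewrite addr_gt0.
rewrite -(ler_pM2l s1).
have -> : (1 + s) * (t * u (s *: z + z) + (1 - t) * u 0) = u (s *: z + z) + s * u 0.
  by rewrite mulrDr !mulrA mulrBr mulr1 [(1 + s) * t]mulrC ts; ring.
move=> le2; rewrite -(ltr_pM2l s0) mulr0; nra.
Unshelve. all: by end_near. Qed.

(** The Hessian of 2 M q has eigenvalues 4 M / r_j^2, whence the right side; its gradient has
    components at most 4 M / r_j in the frame of [Q], whence the sum on the left. *)
Lemma subsolution_on_ellipsoid {R : realType} {n : nat} (k D : R)
    (Omega : set 'rV[R]_n) (u : 'rV[R]_n -> R) (x : 'rV[R]_n)
    (Q : 'M[R]_n) (r : 'I_n -> R) :
    0 < k -> convex_viscosity_subsolution k Omega u -> bounded_set Omega ->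
    (forall z, Omega z -> enorm z <= D) -> Omega x -> rotation Q ->
    (forall j, 0 < r j) ->
    (forall y, quad (fun j => r j ^- 2) Q x y <= 1 -> Omega y) ->
  (- u x) `^ (- n%:R - k - 2) *
    (- u x * (1 + 4 * D * \sum_j (r j)^-1)) `^ (- k)
  <= (4 * - u x) ^+ n / \prod_j r j ^+ 2.
Proof.
move=> k0 [[dO O0] cu vu un vis] bO OD Ox rQ r0 EO.
set M := - u x.
have M0 : 0 < M by rewrite oppr_gt0 un.
pose q := quad (fun j => r j ^- 2) Q x.
pose E := [set y | q y <= 1].
have qx : q x = 0.
  rewrite /q /quad subrr /bilin big1// => j _.
  by rewrite mul0mx mxE mul0r mulr0.
have cE : compact E.
  apply: bounded_closed_compact.
    by case: bO => b [br bO]; exists b; split=> // b' bb' y /EO; exact: bO.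
  have := @closed_comp _ _ q [set s | s <= 1] (fun y _ => continuous_quad _ _ x y).
  by apply; exact: closed_le.
(* The factor 2 M is absorbed into the coefficients so that the lemmas on [quad] apply to [phi]
   itself. *)
pose phi := quad (fun j => 2 * M * r j ^- 2) Q x.
have phiE y : phi y = 2 * M * q y.
  by rewrite /phi /q /quad /bilin mulr_sumr; apply: eq_bigr => j _; ring.
have [z /set_mem Ez zmax] : exists2 z, z \in E &
    forall y, y \in E -> u y - phi y <= u z - phi z.
  apply: EVT_max_rV => //; first by exists x; rewrite /E/= qx.
  have cuE : {within E, continuous u}.
    by apply: continuous_subspaceW cu => y /EO; exact: subset_closure.
  move=> y; apply: cvgB; first exact: cuE.
  by apply: continuous_subspaceT; exact: continuous_quad.
have Oz : Omega z by exact: EO.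
have ux_le : - M <= u z - 2 * M * q z.
  have := zmax x; rewrite phiE qx mulr0 subr0 phiE /M opprK; apply.
  by rewrite inE /E/= qx.
have qz0 : 0 <= q z.
  by apply: bilin_ge0 => j; rewrite invr_ge0 sqr_ge0.
have uz0 := un z Oz.
(* Since u(z) < 0, comparison with the value -M at [x] even gives q(z) < 1/2, so the maximum over
   [E] is a local one. *)
have qz1 : q z < 1 by nra.
have uzM : `|u z| <= M by rewrite ltr0_norm//; nra.
have touch : \forall y \near z, u y - phi y <= u z - phi z.
  have : \forall y \near z, q y < 1.
    have cq : q y @[y --> z] --> q z by exact: continuous_quad.
    exact: (cvgr_lt _ cq _ qz1).
  by apply: filterS => y /ltW qy; apply: zmax; rewrite inE.
have c0 j : 0 <= 2 * M * r j ^- 2 by rewrite !mulr_ge0 ?ltW ?invr_gt0 ?exprn_gt0.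
have := vis phi z (C2_on_quad _ _ _ _) (convex_quad _ _ _ _ c0) Oz touch.
rewrite det_hessian_quad// dot_gradient_quad.
set B := 2 * bilin _ _ _ z.
have P0 : 0 < B - u z.
  apply: (@touching_support_gt0 _ _ Omega u phi z B
    (bilin (fun j => 2 * M * r j ^- 2) Q z z)) => //.
  - exact: un.
  - exact: bilin_ge0.
  - by move=> s; rewrite /phi quad_shift.
have P1 : B - u z <= M * (1 + 4 * D * \sum_j (r j)^-1).
  have BD : B <= 2 * \sum_j 2 * M * D * (r j)^-1.
    rewrite ler_pM2l//; apply: ler_sum => j _.
    have zD : `|(z *m Q) 0 j| <= D.
      by rewrite (le_trans (ler_coord_enorm _ _))// enorm_rotation// OD.
    have zr : `|((z - x) *m Q) 0 j| <= r j by exact: quad_coord_le r0 Ez.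
    have -> : 2 * M * D * (r j)^-1 = 2 * M * r j ^- 2 * (r j * D).
      by field; rewrite gt_eqF.
    apply: ler_wpM2l => //; rewrite (le_trans (ler_norm _))// normrM.
    by rewrite ler_pM.
  rewrite -mulr_sumr in BD.
  have : - u z <= M by rewrite -ltr0_norm.
  move: BD; set S := \sum_j _; nra.
(* Both exponents are negative, so upper bounds on the positive bases bound the left side of the
   equation from below. *)
have powN_le (a b e : R) : 0 < a -> a <= b -> 0 <= e -> b `^ (- e) <= a `^ (- e).
  move=> a0 ab e0; rewrite !powRN lef_pV2 ?posrE ?powR_gt0 ?(lt_le_trans a0)//.
  by rewrite ge0_ler_powR// nnegrE ltW// (lt_le_trans a0).
move=> le1; apply: le_trans (le_trans le1 _).
  apply: ler_pM; rewrite ?powR_ge0//.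
    have -> : - n%:R - k - 2 = - (n%:R + k + 2) by ring.
    by apply: powN_le => //; [rewrite normr_gt0 lt_eqF|rewrite !addr_ge0// ltW].
  by apply: powN_le => //; exact: ltW.
rewrite big_split/= prodr_const card_ord prodfV mulrA -exprMn.
by rewrite mulrA -natrM.
Qed.

(** * Position of x relative to its nearest boundary point *)

(** The foot [w] of the perpendicular from [x] to the supporting hyperplane lies outside [Omega], so
    the segment to it meets the boundary and the distance [d] is at most the height of [x]. By
    Pythagoras the other coordinates vanish. *)
Lemma inner_normal_coord {R : realType} {m : nat} (Omega : set 'rV[R]_m.+1)
    (x0 x : 'rV[R]_m.+1) (Q : 'M[R]_m.+1) :
    open Omega -> rotation Q -> Omega x ->
    (forall y, Omega y -> 0 < ((y - x0) *m Q) 0 ord_max) ->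
    dist_to x (boundary Omega) = enorm (x - x0) ->
  (x - x0) *m Q = enorm (x - x0) *: delta_mx 0 ord_max.
Proof.
move=> oO rQ Ox pos dxE.
set Y := (x - x0) *m Q; set d := enorm (x - x0); set e := delta_mx _ _.
have Yn0 : 0 < Y 0 ord_max by exact: pos.
pose w := x - Y 0 ord_max *: (e *m Q^T).
have QQ := rotation_mulVmx Q rQ.
have nOw : ~ Omega w.
  move/pos; rewrite /w addrAC mulmxBl -/Y -scalemxAl -mulmxA QQ mulmx1.
  by rewrite !mxE !eqxx mulr1 subrr ltxx.
have e1 : enorm e = 1.
  apply/eqP; rewrite -(eqrXn2 (n := 2)) ?enorm_ge0// expr1n sqr_enorm.
  rewrite (bigD1 ord_max)//= big1 ?addr0; first by rewrite mxE !eqxx expr1n.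
  by move=> i /negPf i_max; rewrite mxE i_max expr0n.
have [t /andP[t0 t1] bt] := segment_meets_boundary _ _ _ oO Ox nOw.
have dY : d <= Y 0 ord_max.
  rewrite /d -dxE (le_trans (dist_to_le _ _ _ bt))//.
  have -> : x - (x + t *: (w - x)) = (t * Y 0 ord_max) *: (e *m Q^T).
    by apply/rowP => i; rewrite /w !mxE; ring.
  rewrite enormZ -(enorm_rotation _ _ rQ) -mulmxA QQ mulmx1 e1 mulr1.
  by rewrite ger0_norm ?mulr_ge0// ?ler_piMl// ltW.
have dE : d ^+ 2 = Y 0 ord_max ^+ 2 + \sum_(i | i != ord_max) Y 0 i ^+ 2.
  by rewrite /d -(enorm_rotation _ _ rQ) sqr_enorm (bigD1 ord_max).
have S0 : \sum_(i | i != ord_max) Y 0 i ^+ 2 = 0.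
  apply/eqP; rewrite eq_le sumr_ge0 ?andbT => [|i _]; last exact: sqr_ge0.
  have := enorm_ge0 (x - x0); rewrite -/d; nra.
have Yd : Y 0 ord_max = d.
  apply/eqP; rewrite -(eqrXn2 (n := 2)) ?enorm_ge0 ?ltW//.
  by rewrite dE S0 addr0.
apply/rowP => j; rewrite [RHS]mxE.
have -> : e 0 j = (j == ord_max)%:R by rewrite mxE eqxx.
have [->|jn] := eqVneq j ord_max; first by rewrite Yd mulr1.
move/eqP: S0; rewrite mulr0 psumr_eq0 => [/allP|i _]; last exact: sqr_ge0.
move=> /(_ j (mem_index_enum _)) /implyP /(_ jn).
by rewrite sqrf_eq0 => /eqP.
Qed.

(** * Solving the inequality for M *)

(** Moving every power of [M] to one side gives total exponent n + (n + k + 2) + k, the denominator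
    of [theta]; the bound on [P] adds [k] to the exponent of [d]. A root then yields the claim. *)
Lemma powR_lower_bound {R : realType} (n : nat) (k b kappa L P d M : R) :
    0 < k -> 0 < kappa -> 0 < L -> 0 < d -> 0 < M -> 0 < P -> P <= L / d ->
    M `^ (- n%:R - k - 2) * (M * P) `^ (- k)
      <= (4 * M) ^+ n / (kappa * d `^ (b + 2)) ->
  (kappa / (4 ^+ n * L `^ k)) `^ (2 * n%:R + 2 * k + 2)^-1 * d `^ theta n k b
    <= M.
Proof.
move=> k0 kap0 L0 d0 M0 P0 PL hyp.
have N0 : 0 < 2 * n%:R + 2 * k + 2 :> R.
  by rewrite ltr_wpDl// addr_ge0 ?mulr_ge0// ltW.
set N := 2 * n%:R + 2 * k + 2 in N0 *.
have main : kappa / (4 ^+ n * L `^ k) * d `^ (b + 2 + k) <= M `^ N.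
  have -> : M `^ N = M ^+ n * M `^ (n%:R + k + 2) * M `^ k.
    rewrite -powR_mulrn ?(ltW M0)// -!powRD ?lt0r_neq0 ?implybT//.
    by congr (_ `^ _); rewrite /N; ring.
  rewrite powRD ?lt0r_neq0 ?implybT//.
  move: hyp; have -> : - n%:R - k - 2 = - (n%:R + k + 2) by ring.
  have PkL : P `^ k <= L `^ k / d `^ k.
    have -> : L `^ k / d `^ k = (L / d) `^ k.
      rewrite powRM ?invr_ge0 ?(ltW L0) ?(ltW d0)// -[d^-1]powR_inv1 ?(ltW d0)//.
      by rewrite -powRrM mulN1r powRN.
    by rewrite ge0_ler_powR ?nnegrE// ltW// divr_gt0.
  rewrite !powRN powRM ?(ltW M0) ?(ltW P0)// exprMn.
  have := powR_gt0 k d0; have := powR_gt0 k L0; have := powR_gt0 k M0.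
  have := powR_gt0 k P0; move: PkL.
  have := powR_gt0 (b + 2) d0; have := powR_gt0 (n%:R + k + 2) M0.
  have := exprn_gt0 n M0; have : 0 < 4 ^+ n :> R by rewrite exprn_gt0.
  (* Each power becomes an arbitrary positive real; what remains is to combine kappa E <= f X A B p
     with p g <= l. *)
  move: (4 ^+ n) (M ^+ n) (M `^ (_ + 2)) (d `^ (b + 2)) (P `^ k) (M `^ k)
    (L `^ k) (d `^ k) => f X A E p B l g f0 X0 A0 E0 p0 pl B0 l0 g0.
  rewrite ler_pdivlMr ?mulr_gt0// => hyp.
  rewrite mulrAC ler_pdivrMr ?mulr_gt0//.
  have pgl : p * g <= l by rewrite -ler_pdivlMr.
  have hyp' : kappa * E <= f * X * A * B * p.
    have -> : kappa * E = A^-1 * (B * p)^-1 * (kappa * E) * (A * B * p).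
      by field; rewrite !gt_eqF.
    have -> : f * X * A * B * p = f * X * (A * B * p) by ring.
    by rewrite ler_pM2r ?mulr_gt0.
  rewrite mulrA; apply: (le_trans (y := f * X * A * B * p * g)).
    by rewrite ler_pM2r.
  have -> : X * A * B * (f * l) = f * X * A * B * l by ring.
  by rewrite -mulrA ler_pM2l// !mulr_gt0.
have -> : M = (M `^ N) `^ N^-1 by rewrite -powRrM divff ?gt_eqF// powRr1// ltW.
have -> : d `^ theta n k b = (d `^ (b + 2 + k)) `^ N^-1 by rewrite -powRrM.
have c0 : 0 <= kappa / (4 ^+ n * L `^ k).
  by rewrite divr_ge0 ?(ltW kap0)// mulr_ge0 ?powR_ge0 ?exprn_ge0.
rewrite -powRM ?powR_ge0// ge0_ler_powR ?nnegrE ?powR_ge0 ?invr_ge0 ?(ltW N0)//.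
by rewrite mulr_ge0 ?powR_ge0.
Qed.

(** * Choice of the semi-axes and the resulting constants *)

Section Semiaxes.
Context {R : realType} {m : nat}.
Variables (a eta : 'I_m -> R).
Hypotheses (a_ge1 : forall i, 1 <= a i) (eta_gt0 : forall i, 0 < eta i).

Definition semiaxis_coef (i : 'I_m) : R :=
  (4 * m.+1%:R * eta i) `^ (- (a i)^-1).

(* In the first m directions the length is (d / (4 (m+1) eta_i))^(1 / a_i), so
   that each term eta_i |y_i|^(a_i) is at most d / (4 (m+1)) on the ellipsoid. *)
Definition semiaxis (d : R) (j : 'I_m.+1) : R :=
  if unlift ord_max j is Some i then semiaxis_coef i * d `^ (a i)^-1 else d / 2.

(** The constant in the product of the squared semi-axes; [4^-1] comes from the last one, d / 2. *)
Definition volume_coef : R := 4^-1 * \prod_i semiaxis_coef i ^+ 2.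

(** Bounds [d] times the factor 1 + 4 |D| sum 1 / r_j for d <= h: the [2] is the last axis, and a_i
    >= 1 makes d^(1 - 1/a_i) at most its value at [h]. The absolute value keeps it positive for
    every real [D]. *)
Definition slope_coef (h D : R) : R :=
  h + 4 * `|D| * (2 + \sum_i h `^ (1 - (a i)^-1) / semiaxis_coef i).

Lemma semiaxis_widen d i :
  semiaxis d (widen_ord (leqnSn m) i) = semiaxis_coef i * d `^ (a i)^-1.
Proof.
have -> : widen_ord (leqnSn m) i = lift ord_max i 
  by apply/val_inj; rewrite /= /bump leqNgt ltn_ord.
by rewrite /semiaxis liftK.
Qed.

Lemma semiaxis_max d : semiaxis d ord_max = d / 2.
Proof. by rewrite /semiaxis unlift_none. Qed.

Lemma a_gt0 i : 0 < a i. Proof. exact: lt_le_trans (a_ge1 i). Qed.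

Lemma semiaxis_coef_gt0 i : 0 < semiaxis_coef i.
Proof. by rewrite powR_gt0// !mulr_gt0. Qed.

Lemma semiaxis_gt0 d j : 0 < d -> 0 < semiaxis d j.
Proof.
move=> d0; rewrite /semiaxis; case: unlift => [i|]; last by rewrite divr_gt0.
by rewrite mulr_gt0 ?semiaxis_coef_gt0 ?powR_gt0.
Qed.

Lemma volume_coef_gt0 : 0 < volume_coef.
Proof.
rewrite mulr_gt0 ?invr_gt0// prodr_gt0// => i _.
by rewrite exprn_gt0 ?semiaxis_coef_gt0.
Qed.

Lemma slope_coef_gt0 h D : 0 < h -> 0 < slope_coef h D.
Proof.
move=> h0; rewrite ltr_wpDr// !mulr_ge0// addr_ge0// sumr_ge0// => i _.
by rewrite divr_ge0 ?powR_ge0// ltW ?semiaxis_coef_gt0.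
Qed.

Lemma eta_powR_semiaxis d i : 0 < d ->
  eta i * semiaxis d (widen_ord (leqnSn m) i) `^ a i = d / (4 * m.+1%:R).
Proof.
move=> d0; rewrite semiaxis_widen powRM ?powR_ge0//.
rewrite /semiaxis_coef -!powRrM mulNr mulVf ?gt_eqF ?a_gt0//.
rewrite powRr1 ?(ltW d0)// powR_inv1; last by rewrite ltW// !mulr_gt0.
by field; rewrite !gt_eqF.
Qed.

Lemma prod_semiaxis_sqr d : 0 < d ->
  \prod_j semiaxis d j ^+ 2 = volume_coef * d `^ (abar a + 2).
Proof.
move=> d0; rewrite big_ord_recr/= semiaxis_max.
rewrite (eq_bigr (fun i => semiaxis_coef i ^+ 2 * d `^ (2 / a i))); last first.
  move=> i _; rewrite semiaxis_widen exprMn; congr (_ * _).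
  by rewrite -powR_mulrn ?powR_ge0// -powRrM mulrC.
rewrite big_split/= powRD ?(gt_eqF d0) ?implybT// (powR_mulrn 2 (ltW d0)).
have -> : \prod_i d `^ (2 / a i) = d `^ abar a.
  rewrite /abar; elim/big_rec2 : _ => [|i p s _ ->]; first by rewrite powRr0.
  by rewrite powRD ?(gt_eqF d0) ?implybT.
by rewrite /volume_coef; field.
Qed.

Lemma slope_le h D d : 0 < d -> d <= h ->
  1 + 4 * `|D| * \sum_j (semiaxis d j)^-1 <= slope_coef h D / d.
Proof.
move=> d0 dh; rewrite ler_pdivlMr// mulrDl mul1r -[_ * d]mulrA; apply: lerD => //.
apply: ler_wpM2l; first by rewrite mulr_ge0.
rewrite mulr_suml big_ord_recr/= semiaxis_max.
rewrite addrC; apply: lerD; first by rewrite invf_div mulrVK// unitfE gt_eqF.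
apply: ler_sum => i _; rewrite semiaxis_widen invfM -mulrA mulrC.
apply: ler_wpM2r; first by rewrite invr_ge0 ltW ?semiaxis_coef_gt0.
have -> : (d `^ (a i)^-1)^-1 * d = d `^ (1 - (a i)^-1).
  by rewrite powRB ?(gt_eqF d0) ?implybT// powRr1 ?(ltW d0)// mulrC.
rewrite ge0_ler_powR ?nnegrE ?(ltW d0)//; last by rewrite (le_trans _ dh)// ltW.
by rewrite subr_ge0 invf_le1 ?a_gt0.
Qed.

(** The sum has m terms of size at most d / (4 (m + 1)), hence is at most d / 4, while the last
    coordinate lies between d / 2 and 3 d / 2 < 9 h / 16. *)
Lemma semiaxis_box_sub h d (Y : 'rV[R]_m.+1) : 0 < d -> d < 3 / 8 * h ->
    (forall j, `|(Y - d *: delta_mx 0 ord_max) 0 j| <= semiaxis d j) ->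
  \sum_(i < m) eta i * `|Y 0 (widen_ord (leqnSn m) i)| `^ a i
    < Y 0 ord_max < h.
Proof.
move=> d0 dh Yr.
have := Yr ord_max; rewrite semiaxis_max !mxE !eqxx mulr1 ler_norml => Yd.
have Sd : \sum_(i < m) eta i * `|Y 0 (widen_ord (leqnSn m) i)| `^ a i <= d / 4.
  apply: (le_trans (y := \sum_(i < m) d / (4 * m.+1%:R))).
    apply: ler_sum => i _; rewrite -(eta_powR_semiaxis _ i d0)//.
    rewrite ler_pM2l// ge0_ler_powR ?nnegrE ?(ltW (a_gt0 _))//.
      by rewrite ltW ?semiaxis_gt0.
    have := Yr (widen_ord (leqnSn m) i); rewrite !mxE.
    have /negPf -> : widen_ord (leqnSn m) i != ord_max.
      by rewrite -val_eqE/= ltn_eqF.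
    by rewrite andbF mulr0 subr0.
  rewrite sumr_const card_ord -[leLHS]mulr_natr.
  have -> : d / (4 * m.+1%:R) * m%:R = d / 4 * (m%:R / m.+1%:R).
    by rewrite invfM; ring.
  by rewrite ler_piMr ?divr_ge0 ?(ltW d0)// ler_pdivrMr// mul1r ler_nat.
lra.
Qed.

End Semiaxes.

(** * Assembly of the estimate *)

Theorem theorem1p3 (R : realType) (m : nat) (hm : (2 <= m.+1)%N)
    (k : R) (hk : 0 < k) (D : R) (a eta : 'I_m -> R) (h : R) :
  exists2 C : R, 0 < C &
    forall (Omega : set 'rV[R]_m.+1) (x0 : 'rV[R]_m.+1) (u : 'rV[R]_m.+1 -> R),
      bounded_set Omega -> convex_domain Omega -> Omega 0 ->
      boundary Omega x0 ->
      interior_convex_condition Omega x0 a eta h ->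
      diam Omega = D ->
      convex_viscosity_subsolution_bvp k Omega u ->
      forall x : 'rV[R]_m.+1, Omega x ->
        dist_to x (boundary Omega) = enorm (x - x0) ->
        enorm (x - x0) < 3 / 8 * h ->
        C * dist_to x (boundary Omega) `^ theta m.+1 k (abar a) <= `|u x|.
Proof.
(* [C] is chosen before [Omega], so the sign conditions are decided first; if they fail, no domain
   satisfies the interior convex condition and any [C] works. *)
have [[a1 eta0 h0]|vacuous] := pselect
    [/\ forall i, 1 <= a i, forall i, 0 < eta i & 0 < h]; last first.
  by exists 1 => // Omega x0 u _ _ _ _ [_ a1 eta0 h0 _]; case: vacuous.
pose L := slope_coef a eta h D.
have L0 : 0 < L by exact: slope_coef_gt0.
exists ((volume_coef a eta / (4 ^+ m.+1 * L `^ k))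
          `^ (2 * m.+1%:R + 2 * k + 2)^-1).
  by rewrite powR_gt0// divr_gt0 ?volume_coef_gt0// mulr_gt0 ?exprn_gt0 ?powR_gt0.
move=> Omega x0 u bO dO O0 _ [_ _ _ _ [Q rQ [subO Osub]]] diamO [sub _] x Ox dxE.
rewrite dxE; set d := enorm (x - x0) => dh.
have oO : open Omega by case: dO.
have pos y : Omega y -> 0 < ((y - x0) *m Q) 0 ord_max.
  by move=> Oy; apply: Osub; exists y.
have YE := inner_normal_coord _ _ _ _ oO rQ Ox pos dxE.
have d0 : 0 < d by have := pos x Ox; rewrite YE !mxE !eqxx mulr1.
(* In the rotated coordinates the ellipsoid lies in a box centred at d e_n, which is inside the
   model region; undoing the motion returns to [Omega]. *)
have EO y : quad (fun j => semiaxis a eta d j ^- 2) Q x y <= 1 -> Omega y.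
  move=> yE.
  have : [set (x - x0) *m Q | x in Omega] ((y - x0) *m Q).
    apply: subO; apply: (semiaxis_box_sub _ _ a1 eta0 h d) => // j.
    rewrite -YE -mulmxBl opprB addrA subrK.
    by apply: quad_coord_le => // i; exact: semiaxis_gt0.
  case=> y' Oy' /(congr1 (mulmx^~ Q^T)).
  case: (rQ) => QQ _; rewrite -!mulmxA QQ !mulmx1 => /(congr1 (+%R^~ x0)).
  by rewrite !subrK => <-.
have un : u x < 0 by case: sub => _ _ _ un _; exact: un.
(* The origin belongs to [Omega], so the length of [z] is a distance between two points of
   [Omega]. *)
have OD z : Omega z -> enorm z <= `|D|.
  move=> Oz; rewrite -diamO -[z]subr0 (le_trans (enorm_le_diam _ _ _ bO Oz O0))//.
  exact: ler_norm.
rewrite ltr0_norm//.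
apply: (powR_lower_bound _ _ _ _ _
  (1 + 4 * `|D| * \sum_j (semiaxis a eta d j)^-1) _ _ hk
  _ L0 d0) => //.
- exact: volume_coef_gt0.
- by rewrite oppr_gt0.
- rewrite ltr_wpDr// mulr_ge0 ?mulr_ge0// sumr_ge0// => j _.
  by rewrite invr_ge0 ltW// semiaxis_gt0.
- apply: slope_le => //; move: dh; lra.
- rewrite -prod_semiaxis_sqr//.
  apply: (subsolution_on_ellipsoid _ _ Omega _ _ Q) => // j.
  exact: semiaxis_gt0.
Qed.
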